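(* Let $G$ be a finite soluble group with trivial center such that $\vec \Delta_{\rm norm} (G)$ is strongly connected. If the index $|G:\mathrm{Fit}(G)|$ is a prime number, then $\mathrm{diam}(\vec \Delta_{\rm norm} (G)) \leq 4$.
   Context: $\mathrm{Fit}(G)$ is the Fitting subgroup of $G$. For a group $G$ and $x,y\in G$, write $x\to y$ if $\langle x\rangle$ is normal in $\langle x,y\rangle$ (equivalently, $y$ normalizes $\langle x\rangle$), and $x\leftrightarrow y$ if both $x\to y$ and $y\to x$. The directed normalizing graph $\vec\Gamma_{\rm norm}(G)$ is the simple directed graph with vertex set $G$ and with an arc from $x$ to $y$ ($x\neq y$) whenever $x\to y$. $\mathrm{Univ}(G)$ is the set of those $x\in G$ with $x\leftrightarrow y$ for all $y\in G$. $\vec\Delta_{\rm norm}(G)$ is the induced subgraph of $\vec\Gamma_{\rm norm}(G)$ on $G\setminus\mathrm{Univ}(G)$. A directed graph is strongly connected if for every ordered pair of vertices $(u,v)$ there is a directed path from $u$ to $v$; its diameter $\mathrm{diam}$ is then the supremum, over ordered pairs of distinct vertices $(u,v)$, of the length of a shortest directed path from $u$ to $v$. *)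

(* Defs.v *)
From HB Require Import structures.
From mathcomp Require Import all_boot all_order all_fingroup all_solvable.

Set Implicit Arguments.
Unset Strict Implicit.
Unset Printing Implicit Defensive.

Local Open Scope group_scope.

(* A finite directed graph is given by its vertex set V : {set T} and its arc
   relation e : rel T, which only relates vertices. *)
Section Digraphs.

Variable T : finType.

Definition induced_arc (e : rel T) (V : {set T}) : rel T :=
  [rel x y | [&& x \in V, y \in V & e x y]].

(* [connect] is reachability by a directed path, so every intermediate vertex
   of a path is constrained by e. *)
Definition strongly_connected (V : {set T}) (e : rel T) : Prop :=
  {in V &, forall u v, connect e u v}.

Definition has_dipath (e : rel T) (u v : T) (n : nat) : bool :=
  [exists p : n.-tuple T, path e u p && (last u p == v)].

(* The least length of a directed path from u to v; such a shortest path has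
   fewer than #|T| arcs. The value is #|T| when v is unreachable from u. *)
Definition didist (e : rel T) (u v : T) : nat :=
  find (has_dipath e u v) (iota 0 #|T|).

(* Meaningful for strongly connected graphs only. *)
Definition didiam (V : {set T}) (e : rel T) : nat :=
  \max_(u in V) \max_(v in V | u != v) didist e u v.

End Digraphs.

Section NormalizingGraph.

Variable gT : finGroupType.

Definition norm_to (x y : gT) : bool := <[x]> <| <<[set x; y]>>.

Definition norm_both (x y : gT) : bool := norm_to x y && norm_to y x.

Definition Gamma_norm (G : {set gT}) : rel gT :=
  [rel x y | [&& x \in G, y \in G, x != y & norm_to x y]].

Definition Univ (G : {set gT}) : {set gT} :=
  [set x in G | [forall y in G, norm_both x y]].

Definition Delta_norm_vertices (G : {set gT}) : {set gT} := G :\: Univ G.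

Definition Delta_norm (G : {set gT}) : rel gT :=
  induced_arc (Gamma_norm G) (Delta_norm_vertices G).

End NormalizingGraph.

(* Main.v *)
Require Import Defs.
From HB Require Import structures.
From mathcomp Require Import all_boot all_order all_fingroup all_solvable.

Set Implicit Arguments.
Unset Strict Implicit.
Unset Printing Implicit Defensive.

Local Open Scope group_scope.

(** Since Z(G) = 1, the only universal vertex is 1, so the vertices of Delta are
    the nontrivial elements, and commuting distinct vertices are joined both
    ways.  If some y != 1 has C_F(y) = 1, where F = Fit(G), then y lies outside F and,
    as |G : F| is prime, y has prime order and N_G(<y>) = <y>; hence no
    path from y leaves <y>, against strong connectivity.  So any vertices u and
    v commute with nontrivial c and d of F, and u - c - z - d - v, with z a
    nontrivial element of Z(F), is a walk of length 4. *)

Section Digraphs.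

Variables (T : finType) (e : rel T).

Lemma didist_le_path (u : T) (p : seq T) :
  path e u p -> (didist e u (last u p) <= size p)%N.
Proof.
move=> ep; rewrite /didist leqNgt; apply/negP=> lt_p.
(* [find] never exceeds the length [#|T|] of the searched list, so a path shorter than [didist] has
   its length among the entries. *)
have lt_pT: (size p < #|T|)%N.
  by apply: leq_trans lt_p _; rewrite -[X in (_ <= X)%N](size_iota 0) find_size.
have := before_find 0%N lt_p; rewrite nth_iota // add0n => /negbT/negP; apply.
by apply/existsP; exists (in_tuple p); rewrite /= ep eqxx.
Qed.

(** Arcs join distinct vertices, but neighbours in a walk built from commuting elements may
    coincide; dropping repetitions avoids a case analysis. *)
Lemma shorten_stutters (u : T) (p : seq T) :
    path (fun x y => (x == y) || e x y) u p ->
  exists q, [/\ path e u q, last u q = last u p & (size q <= size p)%N].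
Proof.
elim: p u => [|x p IHp] u /=; first by exists [::].
case/andP=> /orP[/eqP<-|eux] /IHp[q [eq lq sq]].
  by exists q; rewrite lq; split=> //; apply: ltnW.
by exists (x :: q); rewrite /= eux.
Qed.

Lemma connect_closed (S : {pred T}) (u v : T) :
    (forall x y, x \in S -> e x y -> y \in S) ->
  u \in S -> connect e u v -> v \in S.
Proof.
move=> clS Su /connectP[p ep ->].
by elim: p u Su ep => //= x p IHp u Su /andP[/(clS _ _ Su)/IHp].
Qed.

End Digraphs.

Section NormalizingGraph.

Variable gT : finGroupType.
Implicit Types (x y : gT) (G : {group gT}).

Lemma norm_toE x y : norm_to x y = (y \in 'N(<[x]>)).
Proof.
rewrite /norm_to /normal cycle_subG mem_gen ?set21 //= gen_subG subUset !sub1set.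
by rewrite (subsetP (normG _)) ?cycle_id.
Qed.

Lemma commute_norm_to x y : commute x y -> norm_to x y.
Proof.
move=> cxy; rewrite norm_toE (subsetP (cent_sub _)) // cent_cycle.
exact/cent1P.
Qed.

(* A nontrivial universal element has a power z of prime order, also universal.
   If [z, y] != 1, this commutator lies in <z> and in <y>, so <z> <= <y> and z
   commutes with y after all. *)
Lemma Univ_center1 G : 'Z(G) = 1 -> Univ G = 1.
Proof.
move=> Z1; apply/setP=> x; rewrite !inE; apply/andP/eqP=> [|->]; last first.
  split=> //; apply/forall_inP=> y _.
  by rewrite /norm_both !commute_norm_to //; [apply: commute1 | apply/commute_sym/commute1].
case=> Gx /forall_inP Ux; apply/eqP; apply: contraT => nt_x.
have nxG y: y \in G -> y \in 'N(<[x]>) by case/Ux/andP; rewrite norm_toE.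
have nGx y: y \in G -> x \in 'N(<[y]>) by case/Ux/andP=> _; rewrite norm_toE.
have r_pr: prime (pdiv #[x]) by rewrite pdiv_prime // order_gt1.
have [z xz oz] := Cauchy r_pr (pdiv_dvd #[x]).
have Gz: z \in G by apply: subsetP xz; rewrite cycle_subG.
have nGz y: y \in G -> z \in 'N(<[y]>).
  by move=> Gy; apply: subsetP xz; rewrite cycle_subG nGx.
have nzG y: y \in G -> y \in 'N(<[z]>).
  move=> Gy; apply: (subsetP (char_norms _)) (nxG y Gy).
  by rewrite cycle_subgroup_char ?cycle_subG.
have: z \in 'Z(G).
  apply/centerP; split=> // y Gy; have [/eqP/commgP //|nt_zy] := eqVneq [~ z, y] 1.
  have zy_z: [~ z, y] \in <[z]>.
    by rewrite commgEl groupM ?groupV ?cycle_id // memJ_norm ?nzG ?cycle_id.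
  have zy_y: [~ z, y] \in <[y]>.
    by rewrite commgEr groupM ?cycle_id // memJ_norm ?groupV ?cycle_id ?nGz.
  have: <[z]> \subset <[y]>.
    apply: prime_meetG; first by rewrite -orderE oz.
    by apply/trivgPn; exists [~ z, y]; rewrite ?inE ?zy_z.
  by rewrite cycle_subG => /cycleP[k ->]; apply/commute_sym/commuteX/commute_refl.
by rewrite Z1 inE => /eqP z1; rewrite -oz z1 order1 in r_pr.
Qed.

(** The normalizer of [<[y]>] meets [N] trivially, so it embeds in [G / N]; being nontrivial, it has
    prime order and equals its subgroup [<[y]>]. *)
Lemma norm_cycle_prime (G N : {group gT}) (y : gT) :
    N <| G -> prime #|G : N| -> y \in G -> y != 1 -> 'C_N[y] = 1 ->
  'N_G(<[y]>) = <[y]> /\ prime #[y].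
Proof.
move=> nsNG prN Gy nt_y cNy.
have tiNy: <[y]> :&: N = 1.
  apply/trivgP; rewrite -cNy subsetI subsetIr subIset // -cent_cycle.
  by rewrite [_ \subset _]cycle_abelian.
(* For [u] in the intersection, [[~ u, y]] lies in [<[y]>] as [u] normalizes [<[y]>], and in [N] as
   [y] normalizes [N]. *)
have tiMN: 'N_G(<[y]>) :&: N = 1.
  apply/trivgP; rewrite -cNy; apply/subsetP=> u /setIP[/setIP[Gu nyu] Nu].
  rewrite inE Nu; apply/cent1P/commgP; rewrite -in_set1 -[[set 1]]tiNy inE.
  rewrite commgEr groupM ?cycle_id ?memJ_norm ?groupV ?cycle_id //=.
  rewrite -commgEr commgEl groupM ?groupV // memJ_norm //.
  exact: subsetP (normal_norm nsNG) y Gy.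
have nNM: 'N_G(<[y]>) \subset 'N(N).
  exact: subset_trans (subsetIl _ _) (normal_norm nsNG).
have My: y \in 'N_G(<[y]>) by rewrite inE Gy (subsetP (normG _)) ?cycle_id.
have ntM: 'N_G(<[y]>) != 1 by apply/trivgPn; exists y.
have prM: prime #|'N_G(<[y]>)|.
  have: #|'N_G(<[y]>)| %| #|G : N|.
    rewrite -card_quotient ?normal_norm //.
    rewrite (card_isog (quotient_isog nNM _)) ?cardSg ?quotientS ?subsetIl //.
    by rewrite setIC.
  case/primeP: (prN) => _ dvN /dvN/pred2P[/eqP|->] //.
  by rewrite -trivg_card1 (negPf ntM).
have defM: 'N_G(<[y]>) = <[y]>.
  apply/eqP; rewrite eqEsubset cycle_subG My andbT.
  by apply: prime_meetG => //; apply/trivgPn; exists y; rewrite // inE My cycle_id.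
by split=> //; rewrite orderE -defM.
Qed.

End NormalizingGraph.

Theorem proposition5p21 (gT : finGroupType) (G : {group gT})
    (solG : solvable G) (Z1 : 'Z(G) = 1)
    (scG : strongly_connected (Delta_norm_vertices G) (Delta_norm G))
    (prG : prime #|G : 'F(G)|) :
  (didiam (Delta_norm_vertices G) (Delta_norm G) <= 4)%N.
Proof.
have VE x: (x \in Delta_norm_vertices G) = (x != 1) && (x \in G).
  by rewrite inE Univ_center1 // inE.
have arcE x y : Delta_norm G x y =
    [&& (x != 1) && (x \in G), (y != 1) && (y \in G), x != y & norm_to x y].
  rewrite -[LHS]/[&& x \in Delta_norm_vertices G, y \in Delta_norm_vertices G,
                    x \in G, y \in G, x != y & norm_to x y] !VE.
  by case: (x \in G); case: (y \in G); rewrite ?andbF.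
have arc x y: x \in G -> x != 1 -> y \in G -> y != 1 -> commute x y ->
    (x == y) || Delta_norm G x y.
  move=> Gx nt_x Gy nt_y cxy.
  by rewrite arcE Gx Gy nt_x nt_y commute_norm_to //= andbT orbN.
have sFG := subsetP (Fitting_sub G).
have ntF: 'F(G) != 1.
  (* If the Fitting subgroup were trivial, [G] would have prime order, hence be abelian and equal to
     its trivial center. *)
  apply: contraTneq prG => F1; rewrite F1 indexg1; apply/negP=> prG.
  have := center_idP (cyclic_abelian (prime_cyclic prG)); rewrite Z1 => G1.
  by rewrite -G1 cards1 in prG.
have [z Zz nt_z]: exists2 z, z \in 'Z('F(G)) & z != 1.
  by apply/trivgPn; rewrite center_nil_eq1 ?Fitting_nil.
have [Fz cFz] := setIP Zz; have Gz := sFG z Fz.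
have cent_F x: x \in G -> x != 1 -> exists c, [/\ c \in 'F(G), c != 1 & commute x c].
  move=> Gx nt_x; have [cFx | /trivgPn[c]] := eqVneq 'C_('F(G))[x] 1; last first.
    by case/setIP=> Fc /cent1P cxc nt_c; exists c.
  have [Nx pr_x] := norm_cycle_prime (Fitting_normal G) prG Gx nt_x cFx.
  have zx: z \in <[x]>.
    (* As [x] has prime order, [a] generates [<[x]>]; an arc from [a] thus ends in the normalizer of
       [<[x]>], which is [<[x]>]. *)
    have cl a b: a \in <[x]> :\ 1 -> Delta_norm G a b -> b \in <[x]> :\ 1.
      case/setD1P=> nt_a xa; rewrite arcE norm_toE.
      case/and4P=> _ /andP[nt_b Gb] _.
      have ->: <[a]> = <[x]>.
        apply/eqP; rewrite eqEsubset cycle_subG xa prime_meetG -?orderE //.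
        by apply/trivgPn; exists a; rewrite // inE xa cycle_id.
      by move=> nxb; rewrite in_setD1 nt_b -Nx in_setI Gb.
    suff: z \in <[x]> :\ 1 by case/setD1P.
    have xz: connect (Delta_norm G) x z by apply: scG; rewrite VE ?nt_x ?nt_z.
    by apply: connect_closed cl _ xz; rewrite !inE nt_x cycle_id.
  (* No contradiction is drawn: [z] lies in [<[x]>], so it is itself a witness. *)
  by exists z; split=> //; case/cycleP: zx => k ->; apply/commuteX/commute_refl.
apply/bigmax_leqP=> u; rewrite VE => /andP[nt_u Gu].
apply/bigmax_leqP=> v; rewrite VE => /andP[/andP[nt_v Gv] _].
have [c [Fc nt_c cuc]] := cent_F u Gu nt_u.
have [d [Fd nt_d cvd]] := cent_F v Gv nt_v.
have czF x: x \in 'F(G) -> commute z x by move/(centP cFz).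
have cdv: commute d v by exact: commute_sym.
have ccz: commute c z by apply: commute_sym; apply: czF.
have czd := czF d Fd; have [Gc Gd] := (sFG c Fc, sFG d Fd).
(* As [z] is central in the Fitting subgroup, it commutes with both [c] and [d]. *)
have [|q [eq lq sq]] := @shorten_stutters _ (Delta_norm G) u [:: c; z; d; v].
  by rewrite /= !arc.
by have := didist_le_path eq; rewrite lq => /leq_trans; apply.
Qed.
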